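(* Let $G$ be a connected graph (with at least one edge) whose Helmholtzian matrix has exactly $s$ distinct eigenvalues. Then the diameter of $G$ is at most $s$.
   Context: Graphs are finite, simple and undirected. Fix an orientation of every edge (tail $e^-$, head $e^+$) and a cyclic orientation of every triangle. Let $\mathcal{B}$ be the $|E|\times|V|$ matrix with $b_{ev}=-1$ if $v=e^-$, $1$ if $v=e^+$, $0$ otherwise, and $\mathcal{C}$ the $|T|\times|E|$ matrix ($T$ the set of triangles) with $c_{\vartriangle e}=\pm1$ if $e$ is an edge of $\vartriangle$ (sign $+$ iff the orientation of $e$ agrees with that of $\vartriangle$) and $0$ otherwise. The Helmholtzian matrix is $\mathcal{H}(G)=\mathcal{B}\mathcal{B}^{\intercal}+\mathcal{C}^{\intercal}\mathcal{C}$, an edge-indexed real symmetric positive semidefinite matrix; its eigenvalues ($\mathcal{H}$-eigenvalues) do not depend on the chosen orientations. *)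

(* Defs.v *)
From mathcomp Require Import all_boot all_order all_algebra.
From mathcomp Require Import reals.

Set Implicit Arguments.
Unset Strict Implicit.
Unset Printing Implicit Defensive.

Import GRing.Theory.

Local Open Scope ring_scope.

Section Graph.
Variables (V : finType) (adj : rel V).

Definition simple_graph : Prop := symmetric adj /\ irreflexive adj.

Definition connected_graph : Prop := forall x y : V, connect adj x y.

Definition edges : {set {set V}} :=
  [set e : {set V} | [exists x, exists y, adj x y && (e == [set x; y])]].

Definition triangles : {set {set V}} :=
  [set t : {set V} | [exists x, exists y, exists z,
     [&& adj x y, adj y z, adj z x & t == [set x; y; z]]]].

Definition walk (n : nat) (x y : V) : bool :=
  [exists p : n.-tuple V, path adj x p && (last x p == y)].

(* Shortest walks have length less than #|V|; when there is no walk from x to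
   y, the value is the junk value #|V|. *)
Definition dist (x y : V) : nat := find (fun n => walk n x y) (iota 0 #|V|).

Definition diameter : nat := (\max_(x : V) \max_(y : V) dist x y)%N.

(* An edge orientation is given by the tail and head of each edge; the values
   outside [edges] are irrelevant. *)
Definition edge_orientation (etail ehead : {set V} -> V) : Prop :=
  forall e : {set V}, e \in edges -> e = [set etail e; ehead e].

(* A cyclic orientation lists the vertices of each triangle, without
   repetition; the list is read cyclically, through [next]. *)
Definition triangle_orientation (cyc : {set V} -> seq V) : Prop :=
  forall t : {set V}, t \in triangles -> uniq (cyc t) /\ t = [set x in cyc t].

Section Matrices.
Variables (R : nzRingType) (etail ehead : {set V} -> V).
Variable cyc : {set V} -> seq V.

Definition edge_vertex_mx : 'M[R]_(#|edges|, #|V|) :=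
  \matrix_(i < #|edges|, j < #|V|)
    let e : {set V} := enum_val i in let v : V := enum_val j in
    if v == etail e then -1 else if v == ehead e then 1 else 0.

Definition triangle_edge_mx : 'M[R]_(#|triangles|, #|edges|) :=
  \matrix_(i < #|triangles|, j < #|edges|)
    let t : {set V} := enum_val i in let e : {set V} := enum_val j in
    if e \subset t then
      if next (cyc t) (etail e) == ehead e then 1 else -1
    else 0.

Definition helmholtzian : 'M[R]_#|edges| :=
  edge_vertex_mx *m edge_vertex_mx^T + triangle_edge_mx^T *m triangle_edge_mx.

End Matrices.
End Graph.

Definition num_distinct_eigenvalues (F : fieldType) (n : nat) (A : 'M[F]_n)
    (s : nat) : Prop :=
  exists spec : seq F,
    [/\ uniq spec, size spec = s & forall a, (a \in spec) = eigenvalue A a].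

(* Main.v *)
(** The signs cancel so that C B = 0, hence H B = B L and H^i B = B L^i, where
    L = B^T B is the graph Laplacian. As H is real symmetric, it is annihilated
    by p = \prod_a ('X - a) over its s distinct eigenvalues, so p(L) L = 0.
    All off-diagonal entries of L are nonpositive, and negative exactly on
    adjacent pairs, so (L^k)_xy is 0 for k < d(x, y) and nonzero for
    k = d(x, y). If d(x, y) = s + 1 + j, the entry of L^j p(L) L at (x, y) would
    reduce to the one of L^(s+1+j), which is nonzero: a contradiction. *)
Require Import Defs.
From mathcomp Require Import all_boot all_order all_algebra.
From mathcomp Require Import reals complex.

Set Implicit Arguments.
Unset Strict Implicit.
Unset Printing Implicit Defensive.

Import Order.TTheory GRing.Theory Num.Theory.

Local Open Scope ring_scope.

(** * Annihilating polynomials of real symmetric matrices *)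

Lemma horner_mx_sum (R : comNzRingType) n (A : 'M[R]_n.+1) (p : {poly R}) :
  horner_mx A p = \sum_(i < size p) p`_i *: A ^+ i.
Proof.
rewrite -[in LHS](coefK p) poly_def linear_sum; apply: eq_bigr => i _.
by rewrite linearZ rmorphXn /= horner_mx_X.
Qed.

(** Over [R[i]] the matrix becomes Hermitian, hence unitarily similar to a diagonal matrix with real
    entries. Each entry is an eigenvalue of [A], hence a root of the product, so the polynomial
    vanishes on the diagonal and therefore at [A]. *)
Lemma symmetric_horner_mx_eigenvalues (R : rcfType) n (A : 'M[R]_n.+1)
    (spec : seq R) :
  A^T = A -> (forall a, eigenvalue A a -> a \in spec) ->
  horner_mx A (\prod_(a <- spec) ('X - a%:P)) = 0.
Proof.
move=> Asym specP; set p := \prod_(a <- spec) _.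
pose f := real_complex R; pose Af := map_mx f A.
have Af_herm : Af \is hermsymmx.
  apply: realsym_hermsym.
    by apply/is_hermitianmxP; rewrite expr0 scale1r map_mx_id // map_trmx Asym.
  by apply/mxOverP => i j; rewrite mxE complex_real eqxx.
have /orthomx_spectralP AfE := hermitian_normalmx Af_herm.
have d_real := hermitian_spectral_diag_real Af_herm.
set P := spectralmx Af in AfE; set d := spectral_diag Af in AfE d_real.
have Punit : P \in unitmx by exact: spectral_unit.
apply: (@map_mx_inj _ _ f); rewrite map_mx0 map_horner_mx -/Af AfE.
rewrite horner_mx_uconjC // horner_mx_diag.
suff -> : map_mx (horner (map_poly f p)) d = 0.
  by rewrite linear0 mulmx0 mul0mx.
apply/rowP => i; rewrite !mxE.
have dE : f (complex.Re (d 0 i)) = d 0 i.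
  by apply: RRe_real; apply: (mxOverP d_real).
rewrite -dE horner_map /=.
suff /specP a_spec : eigenvalue A (complex.Re (d 0 i)).
  by rewrite (eqP (_ : root p _)) ?rmorph0 // root_prod_XsubC.
suff : eigenvalue Af (d 0 i) by rewrite -dE eigenvalue_map.
apply/eigenvalueP.
(* Eigenvectors are row vectors here: row [i] of [P] is one for [d 0 i], and it is nonzero because
   [P] is invertible. *)
exists (row i P).
  rewrite AfE !mulmxA -row_mul mulmxV // row1 -mulmxA -rowE.
  by apply/rowP => j; rewrite mul_diag_mx !mxE.
apply/negP => /eqP row0; have := congr1 (mulmx^~ (invmx P)) row0.
rewrite -row_mul mulmxV // mul0mx row1 => /rowP /(_ i) /eqP.
by rewrite !mxE !eqxx oner_eq0.
Qed.

(** The value of [p] at [A] is written as an explicit sum so that the dimension can be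
    [#|edges adj|], which is not syntactically a successor. *)
Lemma symmetric_annihilating_poly (R : rcfType) n (A : 'M[R]_n) (s : nat) :
  A^T = A -> num_distinct_eigenvalues A s ->
  exists p : {poly R},
    [/\ p \is monic, size p = s.+1 & \sum_(i < s.+1) p`_i *: A ^+ i = 0].
Proof.
move=> Asym [spec [_ szs specP]].
exists (\prod_(a <- spec) ('X - a%:P)); split.
- exact: monic_prod_XsubC.
- by rewrite size_prod_XsubC szs.
case: n A Asym specP => [|n] A Asym specP; first exact: flatmx0.
rewrite -szs -(size_prod_XsubC spec id) -horner_mx_sum.
by apply: symmetric_horner_mx_eigenvalues => // a; rewrite specP.
Qed.

(** * Walks and distances *)

Section Walks.
Variables (V : finType) (adj : rel V).

Lemma walk0 (x y : V) : walk adj 0 x y = (x == y).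
Proof.
apply/existsP/eqP => [[p]|->]; first by rewrite tuple0 => /eqP.
by exists [tuple]; rewrite /= eqxx.
Qed.

Lemma walkS n (x y : V) :
  walk adj n.+1 x y = [exists z, adj x z && walk adj n z y].
Proof.
apply/existsP/existsP => [[p]|[z /andP[xz /existsP[p zp]]]].
  case/tupleP: p => z p /= /andP[/andP[xz zp] lp].
  by exists z; rewrite xz; apply/existsP; exists p; rewrite zp.
by exists [tuple of z :: p]; rewrite /= xz.
Qed.

(** A path with repetitions removed visits at most [#|V|] vertices; the bound places its length in
    the range searched by [dist]. *)
Lemma connect_walk (x y : V) :
  connect adj x y -> exists2 n, (n < #|V|)%N & walk adj n x y.
Proof.
case/connectP => p0 p0_path ->; case: (shortenP p0_path) => p p_path p_uniq _.
exists (size p); last first.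
  by apply/existsP; exists (in_tuple p); rewrite p_path /=.
by have := max_card (mem (x :: p)); rewrite (card_uniqP p_uniq).
Qed.

Lemma walk_dist (x y : V) : connect adj x y -> walk adj (dist adj x y) x y.
Proof.
move=> /connect_walk[n ltn xny].
have has_walk : has (fun n => walk adj n x y) (iota 0 #|V|).
  by apply/hasP; exists n; rewrite // mem_iota.
have := nth_find 0%N has_walk; rewrite nth_iota //.
by move: has_walk; rewrite has_find size_iota.
Qed.

Lemma not_walk_lt_dist (x y : V) n :
  (n < dist adj x y)%N -> ~~ walk adj n x y.
Proof.
move=> lt_n; have := before_find 0%N lt_n; rewrite nth_iota ?add0n => [->//|].
(* Even when [dist] takes its junk value [#|V|], every smaller [n] lies in the searched range. *)
by apply: (leq_trans lt_n); rewrite -[leqRHS](size_iota 0); apply: find_size.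
Qed.

(** * Powers of a matrix with the off-diagonal sign pattern of a Laplacian *)

Section Powers.
Variables (R : numDomainType) (M : 'M[R]_#|V|).
Hypothesis M_nonadj : forall x y : V, x != y -> ~~ adj x y ->
  M (enum_rank x) (enum_rank y) = 0.
Hypothesis M_adj : forall x y : V, x != y -> adj x y ->
  M (enum_rank x) (enum_rank y) < 0.

(* At the minimal length all walks contribute with the same sign. *)
Lemma expr_mx_shortest_walk n (x y : V) :
    (forall m, (m < n)%N -> ~~ walk adj m x y) ->
  let a := (-1) ^+ n * (M ^+ n) (enum_rank x) (enum_rank y) in
  if walk adj n x y then 0 < a else a == 0.
Proof.
elim: n x y => [|n IHn] x y no_walk /=.
  rewrite walk0 !expr0 mul1r mxE (inj_eq enum_rank_inj).
  by case: eqP => _; rewrite ?ltr01.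
(* One sign goes to the first step of the walk, making the off-diagonal factors [- M x z]
   nonnegative. *)
have sumE : (-1) ^+ n.+1 * (M ^+ n.+1) (enum_rank x) (enum_rank y) =
    \sum_z - M (enum_rank x) (enum_rank z) *
           ((-1) ^+ n * (M ^+ n) (enum_rank z) (enum_rank y)).
  rewrite [M ^+ _]exprS mxE mulr_sumr (reindex (@enum_rank V)) /=; last first.
    by apply: onW_bij; exact: enum_rank_bij.
  by apply: eq_bigr => z _; rewrite exprS mulN1r !mulNr mulrCA.
rewrite {}sumE.
set a := BIG_F.
have a_walk z : if adj x z && walk adj n z y then 0 < a z else a z == 0.
  (* The diagonal entry of [M] has unknown sign, but it multiplies an entry of [M ^+ n] that
     vanishes, since no walk of length [n] joins [x] to [y]. *)
  rewrite /a; have [<-|xz] := eqVneq x z.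
    have := IHn x y (fun m lt_mn => no_walk m (ltnW lt_mn)).
    rewrite (negPf (no_walk n (ltnSn n))) andbF => /eqP ->.
    by rewrite mulr0.
  case: (boolP (adj x z)) => [adj_xz|nadj] /=; last first.
    by rewrite M_nonadj // oppr0 mul0r.
  have no_walk_z m : (m < n)%N -> ~~ walk adj m z y.
    move=> lt_mn; apply: contra (no_walk m.+1 lt_mn) => zy.
    by rewrite walkS; apply/existsP; exists z; rewrite adj_xz.
  have := IHn z y no_walk_z; case: ifP => _ /=.
    by apply: mulr_gt0; rewrite oppr_gt0 M_adj.
  by move=> /eqP ->; rewrite mulr0.
have a_ge0 z : 0 <= a z.
  by have := a_walk z; case: ifP => _ => [/ltW//|/eqP->].
rewrite walkS; case: existsP => [[z xzy]|nwalk].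
  rewrite (bigD1 z) //= ltr_wpDr ?sumr_ge0 //.
  by have := a_walk z; rewrite xzy.
apply/eqP/big1 => z _; have := a_walk z.
by case: ifP => [xzy|_ /eqP //]; case: nwalk; exists z.
Qed.

(** The successor in the exponent is the extra factor L in p(L) L = 0. It is also why the bound is
    [s] and not [s - 1]. *)
Lemma annihilated_dist (s : nat) (c : nat -> R) (x y : V) :
  c s != 0 -> (forall j, \sum_(i < s.+1) c i *: M ^+ (i + j).+1 = 0) ->
  connect adj x y -> (dist adj x y <= s)%N.
Proof.
move=> cs0 M0 xy; rewrite leqNgt; apply/negP => lt_s.
(* This shift makes the top exponent equal to the distance, so only the term [i = s] survives at the
   entry [(x, y)]. *)
pose j := (dist adj x y - s.+1)%N.
have distE : dist adj x y = (s + j).+1 by rewrite -addSn subnKC.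
have /matrixP/(_ (enum_rank x) (enum_rank y)) := M0 j.
rewrite big_ord_recr /= mxE summxE big1 => [|i _]; last first.
  have lt_i : ((i + j).+1 < dist adj x y)%N by rewrite distE !ltnS ltn_add2r.
  have := @expr_mx_shortest_walk (i + j).+1 x y
    (fun m lt_m => not_walk_lt_dist (ltn_trans lt_m lt_i)).
  rewrite /= (negPf (not_walk_lt_dist lt_i)) mulf_eq0 signr_eq0 /= => /eqP Mi0.
  by rewrite mxE Mi0 mulr0.
have := @expr_mx_shortest_walk _ x y (@not_walk_lt_dist x y).
rewrite /= walk_dist // distE => /lt0r_neq0; rewrite mulf_eq0 signr_eq0 /=.
by move=> /negPf Ms; rewrite !mxE add0r => /eqP; rewrite mulf_eq0 (negPf cs0) Ms.
Qed.

End Powers.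
End Walks.

(** * Incidence matrices, the Laplacian and the Helmholtzian *)

Section Helmholtzian.
Variables (V : finType) (adj : rel V).
Hypothesis adj_simple : simple_graph adj.
Variables (etail ehead : {set V} -> V) (cyc : {set V} -> seq V).
Hypothesis e_or : edge_orientation adj etail ehead.
Hypothesis t_or : triangle_orientation adj cyc.
Variable R : comNzRingType.

Let adj_sym : symmetric adj := proj1 adj_simple.
Let adj_irr : irreflexive adj := proj2 adj_simple.

(** These entries of [B] and, below, of [C] are indexed by sets rather than ordinals, so that matrix
    products become sums over edges. *)
Definition incidence (e : {set V}) (v : V) : R :=
  if v == etail e then -1 else if v == ehead e then 1 else 0.

Definition cycle_sign (t e : {set V}) : R :=
  if e \subset t then
    if next (cyc t) (etail e) == ehead e then 1 else -1
  else 0.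

Local Notation B := (edge_vertex_mx adj R etail ehead).
Local Notation C := (triangle_edge_mx adj R etail ehead cyc).
Local Notation H := (helmholtzian adj R etail ehead cyc).

Lemma adj_neq (x y : V) : adj x y -> x != y.
Proof. by apply: contraTneq => ->; rewrite adj_irr. Qed.

Lemma edge_set2 (x y : V) : ([set x; y] \in edges adj) = adj x y.
Proof.
rewrite inE; apply/existsP/idP => [[a /existsP[b /andP[ab /eqP xyE]]]|xy].
  have := set21 x y; have := set22 x y; rewrite !xyE !inE.
  have := set21 a b; have := set22 a b; rewrite -!xyE !inE.
  have aNb := adj_neq ab.
  do 4!case/orP=> /eqP ?; subst; rewrite ?eqxx // in aNb *; by rewrite // adj_sym.
by exists x; apply/existsP; exists y; rewrite xy eqxx.
Qed.

Lemma edge_containing (e : {set V}) (v : V) :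
  e \in edges adj -> v \in e -> exists2 w, w != v & e = [set v; w].
Proof.
rewrite inE => /existsP[x /existsP[y /andP[xy /eqP ->]]].
have xNy := adj_neq xy; rewrite !inE => /orP[/eqP->|/eqP->].
  by exists y; rewrite // eq_sym.
by exists x; rewrite // setUC.
Qed.

Lemma incidence_notin (e : {set V}) (v : V) :
  e \in edges adj -> v \notin e -> incidence e v = 0.
Proof.
move=> /e_or eE; rewrite /incidence eE !inE => /norP[].
by rewrite -eE => /negPf -> /negPf ->.
Qed.

Lemma set2_ends (T : finType) (x y a b : T) : x != y ->
  [set x; y] = [set a; b] -> a = x /\ b = y \/ a = y /\ b = x.
Proof.
move=> xNy xyE; have := set21 x y; have := set22 x y; rewrite !xyE !inE.
by do 2!case/orP=> /eqP ?; subst; rewrite ?eqxx // in xNy *; auto.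
Qed.

Lemma edge_ends (x y : V) : adj x y ->
  etail [set x; y] = x /\ ehead [set x; y] = y \/
  etail [set x; y] = y /\ ehead [set x; y] = x.
Proof.
move=> xy; apply: set2_ends (adj_neq xy) _.
by apply: e_or; rewrite edge_set2.
Qed.

Lemma incidence_mul (x y : V) : adj x y ->
  incidence [set x; y] x * incidence [set x; y] y = -1.
Proof.
move=> xy; have xNy := adj_neq xy; have yNx := xNy; rewrite eq_sym in yNx.
rewrite /incidence; case: (edge_ends xy) => -[-> ->];
  by rewrite !eqxx ?(negPf xNy) ?(negPf yNx) ?(mulr1, mul1r).
Qed.

(** Only an edge containing both [x] and [y] contributes, that is [[set x; y]], and its two ends
    carry opposite signs. *)
Lemma edge_vertex_gram (x y : V) : x != y ->
  (B^T *m B) (enum_rank x) (enum_rank y) = - (adj x y)%:R.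
Proof.
move=> xNy; rewrite mxE.
transitivity (\sum_(e in edges adj) incidence e x * incidence e y).
  by rewrite [RHS]big_enum_val; apply: eq_bigr => i _; rewrite !mxE !enum_rankK.
have incM0 e : e \in edges adj -> e != [set x; y] ->
    incidence e x * incidence e y = 0.
  move=> eE; apply: contraNeq => inc_neq0.
  have xe : x \in e.
    by apply: contraNT inc_neq0 => /(incidence_notin eE) ->; rewrite mul0r.
  have ye : y \in e.
    by apply: contraNT inc_neq0 => /(incidence_notin eE) ->; rewrite mulr0.
  have [w _ ew] := edge_containing eE xe; move: ye; rewrite ew !inE.
  by rewrite eq_sym (negPf xNy) => /eqP ->.
case: (boolP (adj x y)) => [xy|nxy].
  rewrite (bigD1 [set x; y]) ?edge_set2 //= incidence_mul // big1 ?addr0 //.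
  by move=> e /andP[]; exact: incM0.
rewrite oppr0; apply: big1 => e eE; apply: incM0 => //.
by apply: contraNneq nxy => exy; rewrite -edge_set2 -exy.
Qed.

Lemma triangle_adj (t : {set V}) (u v : V) :
  t \in triangles adj -> u \in t -> v \in t -> u != v -> adj u v.
Proof.
rewrite inE => /existsP[x /existsP[y /existsP[z /and4P[xy yz zx /eqP ->]]]].
rewrite !inE -!orbA.
by do 2!case/or3P=> /eqP ->; rewrite ?eqxx // adj_sym.
Qed.

Lemma card_triangle (t : {set V}) : t \in triangles adj -> #|t| = 3.
Proof.
rewrite inE => /existsP[x /existsP[y /existsP[z /and4P[xy yz zx /eqP ->]]]].
rewrite setUC cardsU1 cards2 adj_neq // !inE negb_or.
by rewrite (adj_neq zx) eq_sym (adj_neq yz).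
Qed.

(** Rotating the cyclic list to start at [v] does not change [next]; any vertex of the triangle can
    thus be taken as the first. *)
Lemma triangle_cycle (t : {set V}) (v : V) :
  t \in triangles adj -> v \in t ->
  exists w u, [/\ uniq [:: v; w; u], t = [set v; w; u] &
                  next (cyc t) =1 next [:: v; w; u]].
Proof.
move=> tT vt; have [cyc_uniq tE] := t_or tT.
have cyc_size : size (cyc t) = 3.
  by rewrite -(card_triangle tT) {2}tE cardsE (card_uniqP cyc_uniq).
have : v \in cyc t by rewrite tE inE in vt.
case/rot_to => i s rotE.
have : size (rot i (cyc t)) = 3 by rewrite size_rot.
have := rot_uniq i (cyc t); have := next_rot i cyc_uniq.
have := mem_rot i (cyc t).
rewrite {}rotE cyc_uniq; case: s => [|w [|u [|]]] // memE nextE vwu _.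
exists w, u; split=> //.
by apply/setP => x; rewrite tE inE -memE !inE orbA.
Qed.

(** At a vertex [v] of a triangle, the cyclic orientation leaves along one of its edges and enters
    along the other, so the two contributions cancel; all other edges contribute zero. *)
Lemma triangle_edge_vertex_eq0 : C *m B = 0.
Proof.
apply/matrixP => i j; rewrite !mxE.
set t : {set V} := enum_val i; set v : V := enum_val j.
have tT : t \in triangles adj by exact: enum_valP.
transitivity (\sum_(e in edges adj) cycle_sign t e * incidence e v).
  by rewrite [RHS]big_enum_val; apply: eq_bigr => k _; rewrite !mxE.
have term0 e : e \in edges adj -> ~~ ((e \subset t) && (v \in e)) ->
    cycle_sign t e * incidence e v = 0.
  move=> eE; rewrite negb_and => /orP[/negPf et|ve].
    by rewrite /cycle_sign et mul0r.
  by rewrite incidence_notin ?mulr0.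
have [vt|vt] := boolP (v \in t); last first.
  apply: big1 => e eE; apply: term0 => //.
  by apply: contra vt => /andP[/subsetP]; exact.
have [w [u [vwu tE nextE]]] := triangle_cycle tT vt.
move: (vwu); rewrite /= !inE negb_or => /and3P[/andP[vw vu] wu _].
have wv : w != v by rewrite eq_sym.
have uv : u != v by rewrite eq_sym.
have uw : u != w by rewrite eq_sym.
have wt : w \in t by rewrite tE !inE eqxx orbT.
have ut : u \in t by rewrite tE !inE eqxx orbT.
have adj_vw : adj v w by apply: (triangle_adj tT).
have adj_vu : adj v u by apply: (triangle_adj tT).
have vw_t : [set v; w] \subset t by rewrite subUset !sub1set vt.
have vu_t : [set v; u] \subset t by rewrite subUset !sub1set vt.
have neq_vwu : [set v; u] != [set v; w].
  apply/eqP => /setP/(_ u); rewrite !inE eqxx orbT.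
  by rewrite (negPf uv) (negPf uw).
rewrite (bigD1 [set v; w]) ?edge_set2 //=.
rewrite (bigD1 [set v; u]) ?edge_set2 ?adj_vu //= big1 => [|e]; last first.
  move=> /andP[/andP[eE e_vw] e_vu]; apply: term0 => //.
  apply/negP => /andP[et ve]; have [x xv ex] := edge_containing eE ve.
  have : x \in t by apply: (subsetP et); rewrite ex !inE eqxx orbT.
  rewrite tE !inE (negPf xv) /= => /orP[]/eqP xE; subst x.
    by rewrite ex eqxx in e_vw.
  by rewrite ex eqxx in e_vu.
rewrite addr0 /cycle_sign vw_t vu_t !nextE /incidence.
(* Reversing an edge flips both of its factors: the product is -1 on [[set v; w]] and 1 on
   [[set v; u]] in all four cases. *)
have [[-> ->]|[-> ->]] := edge_ends adj_vw;
have [[-> ->]|[-> ->]] := edge_ends adj_vu;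
  rewrite /= ?eqxx ?(negPf vw, negPf vu, negPf wv, negPf uv, negPf uw, negPf wu)
    ?eqxx ?(mulr1, mul1r, mulrNN, mulrN, mulN1r, opprK);
  by rewrite ?subrr ?addNr.
Qed.

Lemma helmholtzian_sym : H^T = H.
Proof. by rewrite linearD /= !trmx_mul !trmxK. Qed.

Lemma helmholtzian_exp_mul k : H ^+ k *m B = B *m (B^T *m B) ^+ k.
Proof.
elim: k => [|k IHk]; first by rewrite !expr0 mul1mx mulmx1.
have HB : H *m B = B *m (B^T *m B).
  by rewrite mulmxDl -!mulmxA triangle_edge_vertex_eq0 mulmx0 addr0.
transitivity (H ^+ k *m (H *m B)); first by rewrite exprSr mulmxA.
by rewrite HB mulmxA IHk -mulmxA exprSr.
Qed.

(** Multiplying by [B^T] on the left and by B L^j on the right turns H^i into B^T B L^i L^j, which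
    is L^(i+j+1). *)
Lemma laplacian_annihilated (s : nat) (c : nat -> R) :
  \sum_(i < s.+1) c i *: H ^+ i = 0 ->
  forall j, \sum_(i < s.+1) c i *: (B^T *m B) ^+ (i + j).+1 = 0.
Proof.
move=> H0 j; have := congr1 (fun M => B^T *m (M *m B) *m (B^T *m B) ^+ j) H0.
rewrite mul0mx mulmx0 mul0mx => LE; rewrite -[RHS]LE.
rewrite mulmx_suml mulmx_sumr mulmx_suml; apply: eq_bigr => i _.
rewrite -scalemxAl -scalemxAr -scalemxAl helmholtzian_exp_mul mulmxA.
by rewrite -addSn exprD exprS.
Qed.

End Helmholtzian.

Theorem theorem3p3 (R : realType) (V : finType) (adj : rel V)
  (adj_simple : simple_graph adj)
  (adj_connected : connected_graph adj)
  (adj_nonempty : edges adj != set0)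
  (etail ehead : {set V} -> V) (e_or : edge_orientation adj etail ehead)
  (cyc : {set V} -> seq V) (t_or : triangle_orientation adj cyc)
  (s : nat)
  (H_spec : num_distinct_eigenvalues (helmholtzian adj R etail ehead cyc) s) :
  (diameter adj <= s)%N.
Proof.
have [p [p_monic p_size pH]] :=
  symmetric_annihilating_poly (helmholtzian_sym _ _ _ _ _) H_spec.
apply/bigmax_leqP => x _; apply/bigmax_leqP => y _.
apply: (@annihilated_dist _ adj _
  ((edge_vertex_mx adj R etail ehead)^T *m edge_vertex_mx adj R etail ehead)
  _ _ s (fun i => p`_i)) => [a b ab /negPf nab|a b ab adj_ab|||].
- by rewrite edge_vertex_gram // nab oppr0.
- by rewrite edge_vertex_gram // adj_ab oppr_lt0 ltr01.
(* The coefficient at [s] is the leading one, as [p] has size [s.+1]. *)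
- move: p_monic; rewrite monicE lead_coefE p_size /= => /eqP ->.
  exact: oner_neq0.
- exact: laplacian_annihilated pH.
- exact: adj_connected.
Qed.
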